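(* Let $(\mathfrak g,[\cdot,\cdot]_{\mathfrak g},[\![\cdot,\cdot,\cdot]\!]_{\mathfrak g})$ and $(\mathfrak h,[\cdot,\cdot]_{\mathfrak h},[\![\cdot,\cdot,\cdot]\!]_{\mathfrak h})$ be Lie-Yamaguti algebras and $T:\mathfrak h\to\mathfrak g$ a relative Rota-Baxter operator of weight $1$ with respect to an action $(\rho,\mu)$ of $\mathfrak g$ on $\mathfrak h$. For $x,y\in\mathfrak g$ define $\delta(x,y)\in\mathrm{Hom}(\mathfrak h,\mathfrak g)$ by $$\delta(x,y)v=T\big(D(x,y)v\big)-[\![x,y,Tv]\!]_{\mathfrak g},\qquad v\in\mathfrak h.$$ Then $\delta(x,y)$ is a $1$-cocycle of the descent (sub-adjacent) Lie-Yamaguti algebra $(\mathfrak h,[\cdot,\cdot]_T,[\![\cdot,\cdot,\cdot]\!]_T)$ with coefficients in the representation $(\mathfrak g;\rho_T,\mu_T)$.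
   Context: All vector spaces are finite-dimensional over a field $\mathbb K$ of characteristic $0$. **Lie-Yamaguti algebra**: a vector space $\mathfrak g$ with a bilinear bracket $[\cdot,\cdot]:\wedge^2\mathfrak g\to\mathfrak g$ and a trilinear bracket $[\![\cdot,\cdot,\cdot]\!]:\wedge^2\mathfrak g\otimes\mathfrak g\to\mathfrak g$ (skew-symmetric in the first two arguments) such that for all $x,y,z,w,t$: (LY1) $[[x,y],z]+[[y,z],x]+[[z,x],y]+[\![x,y,z]\!]+[\![y,z,x]\!]+[\![z,x,y]\!]=0$; (LY2) $[\![[x,y],z,w]\!]+[\![[y,z],x,w]\!]+[\![[z,x],y,w]\!]=0$; (LY3) $[\![x,y,[z,w]]\!]=[[\![x,y,z]\!],w]+[z,[\![x,y,w]\!]]$; (LY4) $[\![x,y,[\![z,w,t]\!]]\!]=[\![[\![x,y,z]\!],w,t]\!]+[\![z,[\![x,y,w]\!],t]\!]+[\![z,w,[\![x,y,t]\!]]\!]$. **Representation** of $\mathfrak g$: a vector space $V$ with linear $\rho:\mathfrak g\to\mathfrak{gl}(V)$ and bilinear $\mu:\otimes^2\mathfrak g\to\mathfrak{gl}(V)$ such that for all $x,y,z,w\in\mathfrak g$: $\mu([x,y],z)-\mu(x,z)\rho(y)+\mu(y,z)\rho(x)=0$; $\mu(x,[y,z])-\rho(y)\mu(x,z)+\rho(z)\mu(x,y)=0$; $\rho([\![x,y,z]\!])=[D(x,y),\rho(z)]$; $\mu(z,w)\mu(x,y)-\mu(y,w)\mu(x,z)-\mu(x,[\![y,z,w]\!])+D(y,z)\mu(x,w)=0$;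 $\mu([\![x,y,z]\!],w)+\mu(z,[\![x,y,w]\!])=[D(x,y),\mu(z,w)]$; where $D(x,y)=D_{\rho,\mu}(x,y):=\mu(y,x)-\mu(x,y)+[\rho(x),\rho(y)]-\rho([x,y])$. **Center** of a Lie-Yamaguti algebra $\mathfrak h$: $C(\mathfrak h)=\{x\in\mathfrak h: [x,y]=0,\ [\![x,y,z]\!]=0,\ [\![y,z,x]\!]=0\ \ \forall y,z\in\mathfrak h\}$. **Action** of $\mathfrak g$ on a Lie-Yamaguti algebra $(\mathfrak h,[\cdot,\cdot]_{\mathfrak h},[\![\cdot,\cdot,\cdot]\!]_{\mathfrak h})$: a pair $(\rho,\mu)$ such that $(\mathfrak h;\rho,\mu)$ is a representation of $\mathfrak g$ and for all $x,y\in\mathfrak g$, $u,v,w\in\mathfrak h$: $\rho(x)u,\ \mu(x,y)u\in C(\mathfrak h)$; $\rho(x)[u,v]_{\mathfrak h}=\mu(x,y)[u,v]_{\mathfrak h}=0$; $\rho(x)[\![u,v,w]\!]_{\mathfrak h}=\mu(x,y)[\![u,v,w]\!]_{\mathfrak h}=0$. **Relative Rota-Baxter operator of weight $1$** from $\mathfrak h$ to $\mathfrak g$ with respect to an action $(\rho,\mu)$ of $\mathfrak g$ on $\mathfrak h$: a linear map $T:\mathfrak h\to\mathfrak g$ such that for all $u,v,w\in\mathfrak h$ $[Tu,Tv]_{\mathfrak g}=T(\rho(Tu)v-\rho(Tv)u+[u,v]_{\mathfrak h})$, $[\![Tu,Tv,Tw]\!]_{\mathfrak g}=T(D(Tu,Tv)w+\mu(Tv,Tw)u-\mu(Tu,Tw)v+[\![u,v,w]\!]_{\mathfrak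 h})$. **Descent Lie-Yamaguti algebra** of such a $T$: the space $\mathfrak h$ with the Lie-Yamaguti algebra structure $[u,v]_T=\rho(Tu)v-\rho(Tv)u+[u,v]_{\mathfrak h}$, $[\![u,v,w]\!]_T=D(Tu,Tv)w+\mu(Tv,Tw)u-\mu(Tu,Tw)v+[\![u,v,w]\!]_{\mathfrak h}$. **Representation of the descent algebra on $\mathfrak g$**: $(\mathfrak g;\rho_T,\mu_T)$, where $\rho_T(u)(x)=[Tu,x]_{\mathfrak g}+T(\rho(x)u)$, $\mu_T(u,v)(x)=[\![x,Tu,Tv]\!]_{\mathfrak g}-T(D(x,Tu)v-\mu(x,Tv)u)$, with $D_T(u,v)(x):=D_{\rho_T,\mu_T}(u,v)(x)=[\![Tu,Tv,x]\!]_{\mathfrak g}-T(\mu(Tv,x)u-\mu(Tu,x)v)$. **$1$-cocycle**: a linear map $f:\mathfrak h\to\mathfrak g$ with $\delta^T_{\rm I}(f)=0$ and $\delta^T_{\rm II}(f)=0$, where for $u,v,w\in\mathfrak h$ $\delta^T_{\rm I}(f)(u,v)=\rho_T(u)f(v)-\rho_T(v)f(u)-f([u,v]_T)$, $\delta^T_{\rm II}(f)(u,v,w)=D_T(u,v)f(w)+\mu_T(v,w)f(u)-\mu_T(u,w)f(v)-f([\![u,v,w]\!]_T)$. *)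

(* Defs.v *)
From HB Require Import structures.
From mathcomp Require Import all_boot all_order all_algebra.

Set Implicit Arguments.
Unset Strict Implicit.
Unset Printing Implicit Defensive.

Import GRing.Theory.

Local Open Scope ring_scope.

Section LieYamaguti.

Variable K : fieldType.

Definition bilinear_map (U V W : vectType K) (f : U -> V -> W) : Prop :=
  (forall u, linear (f u)) /\ (forall v, linear (fun u => f u v)).

Definition trilinear_map (U V W X : vectType K) (f : U -> V -> W -> X) : Prop :=
  [/\ forall u v, linear (f u v),
      forall u w, linear (fun v => f u v w) &
      forall v w, linear (fun u => f u v w)].

Record is_lie_yamaguti (g : vectType K)
    (br : g -> g -> g) (tr : g -> g -> g -> g) : Prop := IsLieYamaguti {
  ly_br_bilinear : bilinear_map br;
  ly_tr_trilinear : trilinear_map tr;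
  ly_br_skew : forall x y, br x y = - br y x;
  ly_tr_skew : forall x y z, tr x y z = - tr y x z;
  ly_axiom1 : forall x y z,
    br (br x y) z + br (br y z) x + br (br z x) y
      + tr x y z + tr y z x + tr z x y = 0;
  ly_axiom2 : forall x y z w,
    tr (br x y) z w + tr (br y z) x w + tr (br z x) y w = 0;
  ly_axiom3 : forall x y z w,
    tr x y (br z w) = br (tr x y z) w + br z (tr x y w);
  ly_axiom4 : forall x y z w t,
    tr x y (tr z w t) =
      tr (tr x y z) w t + tr z (tr x y w) t + tr z w (tr x y t)
}.

(* Elements of gl(V) are written as functions V -> V; their linearity is part *)
(* of the (multi)linearity fields of is_representation, and an identity in    *)
(* gl(V) is stated by evaluating both sides at an arbitrary vector v.         *)
Definition rep_D (g V : vectType K) (br : g -> g -> g)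
    (rho : g -> V -> V) (mu : g -> g -> V -> V) (x y : g) (v : V) : V :=
  mu y x v - mu x y v + (rho x (rho y v) - rho y (rho x v)) - rho (br x y) v.

Record is_representation (g V : vectType K)
    (br : g -> g -> g) (tr : g -> g -> g -> g)
    (rho : g -> V -> V) (mu : g -> g -> V -> V) : Prop := IsRepresentation {
  rep_rho_bilinear : bilinear_map rho;
  rep_mu_trilinear : trilinear_map mu;
  rep_axiom1 : forall x y z v,
    mu (br x y) z v - mu x z (rho y v) + mu y z (rho x v) = 0;
  rep_axiom2 : forall x y z v,
    mu x (br y z) v - rho y (mu x z v) + rho z (mu x y v) = 0;
  rep_axiom3 : forall x y z v,
    rho (tr x y z) v =
      rep_D br rho mu x y (rho z v) - rho z (rep_D br rho mu x y v);
  rep_axiom4 : forall x y z w v,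
    mu z w (mu x y v) - mu y w (mu x z v) - mu x (tr y z w) v
      + rep_D br rho mu y z (mu x w v) = 0;
  rep_axiom5 : forall x y z w v,
    mu (tr x y z) w v + mu z (tr x y w) v =
      rep_D br rho mu x y (mu z w v) - mu z w (rep_D br rho mu x y v)
}.

Definition in_center (h : vectType K)
    (br : h -> h -> h) (tr : h -> h -> h -> h) (x : h) : Prop :=
  forall y z, [/\ br x y = 0, tr x y z = 0 & tr y z x = 0].

Record is_action (g h : vectType K)
    (brg : g -> g -> g) (trg : g -> g -> g -> g)
    (brh : h -> h -> h) (trh : h -> h -> h -> h)
    (rho : g -> h -> h) (mu : g -> g -> h -> h) : Prop := IsAction {
  act_representation : is_representation brg trg rho mu;
  act_rho_center : forall x u, in_center brh trh (rho x u);
  act_mu_center : forall x y u, in_center brh trh (mu x y u);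
  act_rho_br : forall x u v, rho x (brh u v) = 0;
  act_mu_br : forall x y u v, mu x y (brh u v) = 0;
  act_rho_tr : forall x u v w, rho x (trh u v w) = 0;
  act_mu_tr : forall x y u v w, mu x y (trh u v w) = 0
}.

Definition delta_I (h V : vectType K) (br : h -> h -> h)
    (rho : h -> V -> V) (f : h -> V) (u v : h) : V :=
  rho u (f v) - rho v (f u) - f (br u v).

(* The operator D is recomputed from (br, rho, mu): for the descent algebra   *)
(* below it is D_T = D_{rho_T, mu_T}, built from the descent bracket.         *)
Definition delta_II (h V : vectType K)
    (br : h -> h -> h) (tr : h -> h -> h -> h)
    (rho : h -> V -> V) (mu : h -> h -> V -> V) (f : h -> V) (u v w : h) : V :=
  rep_D br rho mu u v (f w) + mu v w (f u) - mu u w (f v) - f (tr u v w).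

Definition is_cocycle1 (h V : vectType K)
    (br : h -> h -> h) (tr : h -> h -> h -> h)
    (rho : h -> V -> V) (mu : h -> h -> V -> V) (f : h -> V) : Prop :=
  [/\ linear f,
      forall u v, delta_I br rho f u v = 0 &
      forall u v w, delta_II br tr rho mu f u v w = 0].

Section Descent.

Variables (g h : vectType K).
Variables (brg : g -> g -> g) (trg : g -> g -> g -> g).
Variables (brh : h -> h -> h) (trh : h -> h -> h -> h).
Variables (rho : g -> h -> h) (mu : g -> g -> h -> h).
Variable T : 'Hom(h, g).

Let D := rep_D brg rho mu.

Definition descent_br (u v : h) : h := rho (T u) v - rho (T v) u + brh u v.

Definition descent_tr (u v w : h) : h :=
  D (T u) (T v) w + mu (T v) (T w) u - mu (T u) (T w) v + trh u v w.

Definition is_relative_rota_baxter : Prop :=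
  (forall u v, brg (T u) (T v) = T (rho (T u) v - rho (T v) u + brh u v)) /\
  (forall u v w, trg (T u) (T v) (T w) =
     T (D (T u) (T v) w + mu (T v) (T w) u - mu (T u) (T w) v + trh u v w)).

Definition descent_rho (u : h) (x : g) : g := brg (T u) x + T (rho x u).

Definition descent_mu (u v : h) (x : g) : g :=
  trg x (T u) (T v) - T (D x (T u) v - mu x (T v) u).

Definition delta_map (x y : g) (v : h) : g := T (D x y v) - trg x y (T v).

End Descent.

End LieYamaguti.

(* Main.v *)
Require Import Defs.
From HB Require Import structures.
From mathcomp Require Import all_boot all_order all_algebra.
From mathcomp Require Import ring.

Set Implicit Arguments.
Unset Strict Implicit.
Unset Printing Implicit Defensive.

Import GRing.Theory VectorInternalTheory.

Local Open Scope ring_scope.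

(** The pair (L, E) with L = trg x y acting on g and E = D(x, y) acting on h is
    a derivation of the whole situation: L is a derivation of both brackets of
    g, E one of both brackets of h, and E intertwines rho and mu with L by the
    Leibniz rule.  The map delta(x, y) = T \o E - L \o T is the failure of T to
    commute with this derivation.  Transporting T along the infinitesimal
    automorphisms 1 + tL and 1 + tE, where t^2 = 0, gives a map that satisfies
    the same two Rota-Baxter identities to first order in t, and comparing the
    coefficients of t yields exactly delta_I = 0 and delta_II = 0.

    The computation behind this holds for every derivation pair
    ([derivation_pair_cocycle]).  On the values of T, apply L to
    T [u, v]_T = [T u, T v] and to its ternary analogue; on the descent
    brackets, apply E by the Leibniz rules; then use the Rota-Baxter identity
    once more on the mixed terms such as [T u, T (E v)].  Everything cancels,
    with no correction from the brackets of h because E is a derivation of them.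

    What is specific to actions is used twice.  It makes D(x, y) a derivation of
    the brackets of h for a trivial reason: it kills brackets and has central
    values ([inner_derivation_pair]).  It also gives the closed formula for the
    operator D_T attached to the descent representation ([descent_DE]), where
    brackets in h with an element rho z v must vanish and rho must kill
    [u, v]_h. *)

(** * Additive identities in vector spaces *)

Section Linear.

Variables (K : fieldType) (U V : vectType K) (f : U -> V).
Hypothesis f_lin : linear f.

Lemma linear_morphD : {morph f : u v / u + v}.
Proof. by move=> u v; rewrite -[u]scale1r f_lin !scale1r. Qed.

Lemma linear_morphB : {morph f : u v / u - v}.
Proof. by move=> u v; rewrite addrC -scaleN1r f_lin scaleN1r addrC. Qed.

Lemma linear_morph0 : f 0 = 0.
Proof. by rewrite -(subrr 0) linear_morphB subrr. Qed.

Lemma linear_morphN : {morph f : u / - u}.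
Proof. by move=> u; rewrite -sub0r linear_morphB linear_morph0 sub0r. Qed.

End Linear.

(** Coordinates reduce an additive identity between vectors to one between
    scalars, where commutative ring normalization applies. *)
Ltac vector_ring :=
  apply: v2r_inj; apply/rowP => ?;
  rewrite ?(raddf0 v2r, raddfN v2r, raddfD v2r) ?mxE; ring.

(** * Derivations of an action *)

Section Action.

Variables (K : fieldType) (g h : vectType K).
Variables (brg : g -> g -> g) (trg : g -> g -> g -> g).
Variables (brh : h -> h -> h) (trh : h -> h -> h -> h).
Variables (rho : g -> h -> h) (mu : g -> g -> h -> h).

Local Notation D := (rep_D brg rho mu).

(** Infinitesimal automorphisms of the action: to first order in t, the maps
    1 + tL and 1 + tE preserve all brackets, rho and mu. *)
Record derivation_pair (L : g -> g) (E : h -> h) : Prop := DerivationPair {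
  der_linearL : linear L;
  der_linearE : linear E;
  der_brg : forall a b, L (brg a b) = brg (L a) b + brg a (L b);
  der_trg : forall a b c,
    L (trg a b c) = trg (L a) b c + trg a (L b) c + trg a b (L c);
  der_brh : forall u v, E (brh u v) = brh (E u) v + brh u (E v);
  der_trh : forall u v w,
    E (trh u v w) = trh (E u) v w + trh u (E v) w + trh u v (E w);
  der_rho : forall a u, E (rho a u) = rho (L a) u + rho a (E u);
  der_mu : forall a b u,
    E (mu a b u) = mu (L a) b u + mu a (L b) u + mu a b (E u)
}.

Hypothesis LYg : is_lie_yamaguti brg trg.
Hypothesis LYh : is_lie_yamaguti brh trh.
Hypothesis act : is_action brg trg brh trh rho mu.

Let rep := act_representation act.

Let brg_linr a : linear (brg a) := proj1 (ly_br_bilinear LYg) a.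
Let brh_linl v : linear (brh^~ v) := proj2 (ly_br_bilinear LYh) v.
Let trg_lin1 b c : linear (fun a => trg a b c).
Proof. by case: (ly_tr_trilinear LYg). Qed.
Let trg_lin3 a b : linear (trg a b).
Proof. by case: (ly_tr_trilinear LYg). Qed.
Let rho_linr a : linear (rho a) := proj1 (rep_rho_bilinear rep) a.
Let rho_linl u : linear (rho^~ u) := proj2 (rep_rho_bilinear rep) u.
Let mu_lin1 b u : linear (fun a => mu a b u).
Proof. by case: (rep_mu_trilinear rep). Qed.
Let mu_lin2 a u : linear (fun b => mu a b u).
Proof. by case: (rep_mu_trilinear rep). Qed.
Let mu_lin3 a b : linear (mu a b).
Proof. by case: (rep_mu_trilinear rep). Qed.

Lemma rep_D_skew a b u : D a b u = - D b a u.
Proof.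
rewrite /rep_D (ly_br_skew LYg a b) (linear_morphN (rho_linl u)); vector_ring.
Qed.

Lemma rep_DBl a a' b u : D (a - a') b u = D a b u - D a' b u.
Proof.
rewrite /rep_D (ly_br_skew LYg _ b) (ly_br_skew LYg a b) (ly_br_skew LYg a' b).
rewrite (linear_morphB (brg_linr b)) !(linear_morphN (rho_linl u)).
rewrite !(linear_morphB (rho_linl _)) (linear_morphB (rho_linr b)).
rewrite (linear_morphB (mu_lin1 b u)) (linear_morphB (mu_lin2 b u)).
vector_ring.
Qed.

Lemma rep_D_linear a b : linear (D a b).
Proof.
move=> k u v; rewrite /rep_D !mu_lin3 !rho_linr.
rewrite !(scalerBr, scalerDr).
vector_ring.
Qed.

(** D is built from mu, rho and the bracket of g, so it inherits their Leibniz
    rules. *)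
Lemma der_rep_D L E (der : derivation_pair L E) a b u :
  E (D a b u) = D (L a) b u + D a (L b) u + D a b (E u).
Proof.
rewrite /rep_D.
rewrite !(linear_morphB (der_linearE der), linear_morphD (der_linearE der)).
rewrite !(der_mu der) !(der_rho der) (der_brg der) (linear_morphD (rho_linl _)).
rewrite !(linear_morphD (rho_linr _)).
vector_ring.
Qed.

Lemma brh_rho_l a u v : brh (rho a u) v = 0.
Proof. by case: (act_rho_center act a u v v). Qed.

Lemma brh_rho_r a u v : brh v (rho a u) = 0.
Proof. by rewrite (ly_br_skew LYh) brh_rho_l oppr0. Qed.

Lemma in_centerD u v :
  in_center brh trh u -> in_center brh trh v -> in_center brh trh (u + v).
Proof.
have [lin3 _ lin1] := ly_tr_trilinear LYh.
move=> cu cv y z; have [bu tu t'u] := cu y z; have [bv tv t'v] := cv y z.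
rewrite (linear_morphD (brh_linl y)) (linear_morphD (lin1 _ _)).
by rewrite (linear_morphD (lin3 _ _)) bu tu t'u bv tv t'v !addr0.
Qed.

Lemma in_centerN u : in_center brh trh u -> in_center brh trh (- u).
Proof.
have [lin3 _ lin1] := ly_tr_trilinear LYh.
move=> cu y z; have [bu tu t'u] := cu y z.
rewrite (linear_morphN (brh_linl y)) (linear_morphN (lin1 _ _)).
by rewrite (linear_morphN (lin3 _ _)) bu tu t'u !oppr0.
Qed.

Lemma rep_D_center a b u : in_center brh trh (D a b u).
Proof.
have cmu := act_mu_center act; have crho := act_rho_center act.
by rewrite /rep_D;
   do ![exact: cmu | exact: crho | apply: in_centerD | apply: in_centerN].
Qed.

Lemma rep_D_brh a b u v : D a b (brh u v) = 0.
Proof.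
rewrite /rep_D !(act_mu_br act) !(act_rho_br act) !(linear_morph0 (rho_linr _)).
by rewrite !(subr0, addr0).
Qed.

Lemma rep_D_trh a b u v w : D a b (trh u v w) = 0.
Proof.
rewrite /rep_D !(act_mu_tr act) !(act_rho_tr act) !(linear_morph0 (rho_linr _)).
by rewrite !(subr0, addr0).
Qed.

(** Over g, rho and mu the Leibniz rules are axioms of Lie-Yamaguti algebras and
    representations; over h both sides of each rule vanish. *)
Lemma inner_derivation_pair x y : derivation_pair (trg x y) (D x y).
Proof.
split=> [||a b|a b c|u v|u v w|a u|a b u].
- exact: trg_lin3.
- exact: rep_D_linear.
- exact: ly_axiom3 LYg _ _ _ _.
- exact: ly_axiom4 LYg _ _ _ _ _.
- have [bu _ _] := rep_D_center x y u v v.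
  have [bv _ _] := rep_D_center x y v u u.
  by rewrite rep_D_brh bu (ly_br_skew LYh) bv oppr0 addr0.
- have [_ tu _] := rep_D_center x y u v w.
  have [_ tv _] := rep_D_center x y v u w.
  have [_ _ tw] := rep_D_center x y w u v.
  by rewrite rep_D_trh tu (ly_tr_skew LYh) tv tw oppr0 !addr0.
- by rewrite (rep_axiom3 rep) subrK.
- by rewrite (rep_axiom5 rep) subrK.
Qed.

(** * The cocycle identities *)

Variable T : 'Hom(h, g).
Hypothesis rrbT : is_relative_rota_baxter brg trg brh trh rho mu T.

Local Notation brT := (descent_br brh rho T).
Local Notation trT := (descent_tr brg trh rho mu T).
Local Notation rhoT := (descent_rho brg rho T).
Local Notation muT := (descent_mu brg trg rho mu T).
Local Notation DT := (rep_D brT rhoT muT).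

Let T_br u v : brg (T u) (T v) = T (brT u v).
Proof. exact: rrbT.1. Qed.
Let T_tr u v w : trg (T u) (T v) (T w) = T (trT u v w).
Proof. exact: rrbT.2. Qed.

Lemma descent_rho_comp u v a :
  rhoT u (rhoT v a) = brg (T u) (brg (T v) a)
                        + T (rho (T u) (rho a v) + rho (brg (T v) a) u).
Proof.
rewrite /descent_rho (linear_morphD (brg_linr _)) (linear_morphD (rho_linl _)).
rewrite T_br /descent_br brh_rho_r addr0 !(raddfD T, raddfN T).
vector_ring.
Qed.

(** The part in g reduces to (LY1) for T u, T v and a; in the part under T, the
    definition of D(a, T u) absorbs everything but mu. *)
Lemma descent_DE u v a :
  DT u v a = trg (T u) (T v) a - T (mu (T v) a u - mu (T u) a v).
Proof.
rewrite {1}/rep_D !descent_rho_comp /descent_mu /descent_rho -T_br.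
rewrite /descent_br !(linear_morphB (rho_linr _), linear_morphD (rho_linr _)).
rewrite !(act_rho_br act) !addr0 /rep_D.
rewrite (ly_br_skew LYg a (T u)) (ly_br_skew LYg a (T v)).
rewrite !(linear_morphN (rho_linl _)).
(* Subtracting (LY1), which is a sum equal to 0, from the difference of the two
   sides leaves only terms that cancel. *)
have -> : trg (T u) (T v) a = brg (T u) (brg (T v) a)
    - brg (T v) (brg (T u) a) - brg (brg (T u) (T v)) a
    + trg a (T v) (T u) - trg a (T u) (T v).
  have := ly_axiom1 LYg (T u) (T v) a.
  rewrite (ly_br_skew LYg (brg (T v) a)) (ly_br_skew LYg a (T u)).
  rewrite (ly_br_skew LYg (- _)) (linear_morphN (brg_linr _)).
  rewrite (ly_tr_skew LYg (T v) a) => ly1.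
  apply/eqP; rewrite -subr_eq0 -[X in _ == X]ly1; apply/eqP; vector_ring.
rewrite !(raddfD T, raddfN T).
vector_ring.
Qed.

Section DerivationPair.

Variables (L : g -> g) (E : h -> h).
Hypothesis der : derivation_pair L E.

Local Notation delta v := (T (E v) - L (T v)).

Lemma der_descent_br u v :
  E (brT u v) = rho (L (T u)) v + rho (T u) (E v)
    - (rho (L (T v)) u + rho (T v) (E u)) + (brh (E u) v + brh u (E v)).
Proof.
rewrite /descent_br (linear_morphD (der_linearE der)).
by rewrite (linear_morphB (der_linearE der)) !(der_rho der) (der_brh der).
Qed.

Lemma der_descent_tr u v w :
  E (trT u v w) = (D (L (T u)) (T v) w + D (T u) (L (T v)) w + D (T u) (T v) (E w))
    + (mu (L (T v)) (T w) u + mu (T v) (L (T w)) u + mu (T v) (T w) (E u))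
    - (mu (L (T u)) (T w) v + mu (T u) (L (T w)) v + mu (T u) (T w) (E v))
    + (trh (E u) v w + trh u (E v) w + trh u v (E w)).
Proof.
rewrite /descent_tr (linear_morphD (der_linearE der)).
rewrite (linear_morphB (der_linearE der)) (linear_morphD (der_linearE der)).
by rewrite (der_rep_D der) !(der_mu der) (der_trh der).
Qed.

(** The two terms containing rho (T (E v)) cancel: one comes from the bracket
    [T u, T (E v)], the other from the definition of rho_T. *)
Lemma descent_rho_delta u v :
  rhoT u (delta v) = T (rho (T u) (E v) - rho (L (T v)) u + brh u (E v))
                       - brg (T u) (L (T v)).
Proof.
rewrite /descent_rho (linear_morphB (brg_linr _)) (linear_morphB (rho_linl _)).
rewrite T_br /descent_br !(raddfD T, raddfN T).
vector_ring.
Qed.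

Lemma descent_D_delta u v w :
  DT u v (delta w) =
    T (D (T u) (T v) (E w) + mu (T v) (L (T w)) u - mu (T u) (L (T w)) v
        + trh u v (E w))
      - trg (T u) (T v) (L (T w)).
Proof.
rewrite descent_DE (linear_morphB (trg_lin3 _ _)) !(linear_morphB (mu_lin2 _ _)).
rewrite T_tr /descent_tr !(raddfD T, raddfN T).
vector_ring.
Qed.

Lemma descent_mu_delta u v w :
  muT v w (delta u) =
    T (D (L (T u)) (T v) w + mu (T v) (T w) (E u) - mu (L (T u)) (T w) v
        + trh (E u) v w)
      - trg (L (T u)) (T v) (T w).
Proof.
rewrite /descent_mu (linear_morphB (trg_lin1 _ _)) rep_DBl.
rewrite (linear_morphB (mu_lin1 _ _)) T_tr /descent_tr !(raddfD T, raddfN T).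
vector_ring.
Qed.

Theorem derivation_pair_cocycle :
  is_cocycle1 brT trT rhoT muT (fun v => delta v).
Proof.
split=> [k u v|u v|u v w].
- rewrite (der_linearE der) !linearP (der_linearL der) scalerBr; vector_ring.
- rewrite /delta_I !descent_rho_delta der_descent_br -T_br (der_brg der).
  rewrite (ly_br_skew LYg (L _)) (ly_br_skew LYh (E _)) !(raddfD T, raddfN T).
  vector_ring.
- rewrite /delta_II descent_D_delta !descent_mu_delta der_descent_tr -T_tr.
  rewrite (der_trg der) (rep_D_skew (L (T v))) (ly_tr_skew LYg (L (T v))).
  rewrite (ly_tr_skew LYh (E v)) !(raddfD T, raddfN T).
  vector_ring.
Qed.

End DerivationPair.

End Action.

Theorem proposition5p4 (K : fieldType) (charK0 : [pchar K] =i pred0)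
    (g h : vectType K)
    (brg : g -> g -> g) (trg : g -> g -> g -> g)
    (brh : h -> h -> h) (trh : h -> h -> h -> h)
    (rho : g -> h -> h) (mu : g -> g -> h -> h) (T : 'Hom(h, g))
    (LYg : is_lie_yamaguti brg trg) (LYh : is_lie_yamaguti brh trh)
    (act : is_action brg trg brh trh rho mu)
    (rrbT : is_relative_rota_baxter brg trg brh trh rho mu T)
    (x y : g) :
  is_cocycle1 (descent_br brh rho T) (descent_tr brg trh rho mu T)
    (descent_rho brg rho T) (descent_mu brg trg rho mu T)
    (delta_map brg trg rho mu T x y).
Proof.
exact (derivation_pair_cocycle LYg LYh act rrbT
         (inner_derivation_pair LYg LYh act x y)).
Qed.
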